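(* Assume that the repository has $n$ packages, contains at most $d$ defects and at most $u$ unknown dependencies, and has no conflicts. Any adaptive algorithm for Maximal Sub-repository must make $$\Omega\left(\binom{u+d}{d}+d\log\left(\frac{n}{d}\right)\right)$$ queries.
   Context: A repository consists of a finite set $P$ of $n$ packages, a set $K\subseteq P\times P$ of known dependencies, a set $U\subseteq P\times P$ of unknown dependencies, a set $C$ of unknown conflicts (unordered pairs of distinct packages), and a set $D\subseteq P$ of defects. A pair $(q,p)\in K\cup U$ means that $q$ depends on $p$: any installation including $q$ but not $p$ fails. The digraph $(P,K)$ is acyclic ($U$ may create cycles). An installation is a subset $I\subseteq P$; it is successful iff it contains no defect, contains $p$ whenever it contains $q$ with $(q,p)\in K\cup U$, and contains no two packages $p,q$ with $\{p,q\}\in C$. Defects are the packages that cannot be part of any successful installation; thus a package that depends on a defect is itself a defect, i.e. $((P\setminus D)\times D)\cap(K\cup U)=\emptyset$. An algorithm is given $P$, $K$ and the bounds $d,u$. A query is an installation $I\subseteq P$; an oracle answers whether it is successful. An adaptive algorithm asks one query at a time and may choose each query depending on previous answers. The cost is the number of queries. Maximal Sub-repository: find a maximum-size set of packages $P_{max}\subseteq P$ that can be successfully installed.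
   Formalization: The formal theorem assumes d ≥ 1 and u + d ≤ n: for d = 0 the term log(n/d) is undefined and no query is needed; for u far above n the bound fails (with d = 1, n + 1 queries always suffice). *)

(* Defs.v *)
From mathcomp Require Import all_boot.

Set Implicit Arguments.
Unset Strict Implicit.
Unset Printing Implicit Defensive.

Definition acyclic (P : finType) (K : {set P * P}) : Prop :=
  forall s : seq P, cycle (fun q p => (q, p) \in K) s -> s = [::].

(* A pair (q, p) in K or U means that q depends on p. *)
Definition success (P : finType) (K U : {set P * P}) (C : {set {set P}})
    (D I : {set P}) : bool :=
  [&& [disjoint I & D],
      [forall e in K :|: U, (e.1 \in I) ==> (e.2 \in I)] &
      [forall c in C, ~~ (c \subset I)]].

(* [defectsP] states that the defects are exactly the packages contained in no
   successful installation; in particular, a package that depends on a defect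
   is a defect. *)
Record repository (P : finType) := Repository {
  known : {set P * P};
  unknown : {set P * P};
  conflicts : {set {set P}};
  defects : {set P};
  known_acyclic : acyclic known;
  conflicts_pair : forall c, c \in conflicts -> #|c| = 2;
  defectsP : forall p, p \in defects <->
    ~ (exists I : {set P},
         p \in I /\ success known unknown conflicts defects I)
}.

Definition successful (P : finType) (r : repository P) (I : {set P}) : bool :=
  success (known r) (unknown r) (conflicts r) (defects r) I.

Definition max_subrepository (P : finType) (r : repository P)
    (S : {set P}) : Prop :=
  successful r S /\ forall I : {set P}, successful r I -> #|I| <= #|S|.

Definition admissible (P : finType) (d u : nat) (r : repository P) : Prop :=
  [/\ #|defects r| <= d, #|unknown r| <= u & conflicts r = set0].

(* An adaptive algorithm is a decision tree: [Query J yes no] asks whether J is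
   successful and continues with [yes] or [no] according to the answer. *)
Inductive adaptive (P : finType) : Type :=
| Output of {set P}
| Query of {set P} & adaptive P & adaptive P.

Fixpoint result (P : finType) (oracle : {set P} -> bool) (t : adaptive P)
    : {set P} :=
  match t with
  | Output X => X
  | Query J yes no => result oracle (if oracle J then yes else no)
  end.

Fixpoint queries (P : finType) (oracle : {set P} -> bool) (t : adaptive P)
    : nat :=
  match t with
  | Output _ => 0
  | Query J yes no => (queries oracle (if oracle J then yes else no)).+1
  end.

(* The algorithm A receives the known dependencies; P, d and u are fixed before
   A is, so that A may depend on them as well. *)
Definition solves (P : finType) (d u : nat)
    (A : {set P * P} -> adaptive P) : Prop :=
  forall r : repository P, admissible d u r ->
    max_subrepository r (result (successful r) (A (known r))).

(* Main.v *)
(* Take K empty, so that the algorithm is one fixed decision tree, and recall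
   that without conflicts the answer is always the complement of D.
   If U is empty as well, every D with at most d elements is possible, and the
   tree must have a leaf for each of them: some D costs log2 'C(n, d) queries.
   If instead D is a d-subset of a fixed set Q of u + d packages and U is a
   directed cycle through Q \ D, then a successful installation that meets Q
   meets it exactly in Q \ D; so a query meeting Q succeeds for at most one of
   the 'C(u + d, d) candidates D, and its failure excludes only that one. *)
Require Import Defs.
From HB Require Import structures.
From mathcomp Require Import all_boot all_order all_algebra.
From mathcomp Require Import all_classical all_reals all_analysis.
From mathcomp Require Import lra.

Set Implicit Arguments.
Unset Strict Implicit.
Unset Printing Implicit Defensive.

(** * Adversary arguments on decision trees *)

Section DecisionTrees.
Variables (P T : finType) (f : T -> {set P} -> bool).
Implicit Types (F : {set T}) (t : adaptive P).

(** The adversary gives the answer shared by at least half of the remaining candidates. At a leaf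
    the output is constant, so injectivity leaves at most one candidate. *)
Lemma decision_tree_leaves t F : F != finset.set0 ->
  {in F &, injective (fun x => result (f x) t)} ->
  exists2 x, x \in F & #|F| <= 2 ^ queries (f x) t.
Proof.
elim: t F => [X|J yes IHyes no IHno] F F0 inj /=.
  have /finset.set0Pn[x xF] := F0.
  exists x => //; rewrite expn0; apply/card_le1_eqP => y z yF zF.
  exact: inj.
have cF := cardsID [set x | f x J] F.
have step (b : bool) (G : {set T}) : G \subset F ->
    {in G, forall x, f x J = b} ->
    #|F| <= #|G|.*2 ->
    (forall F' : {set T}, F' != finset.set0 ->
      {in F' &, injective
        (fun x => result (f x) (if b then yes else no))} ->
      exists2 x, x \in F' &
        #|F'| <= 2 ^ queries (f x) (if b then yes else no)) ->
    exists2 x, x \in F &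
      #|F| <= 2 ^ (queries (f x) (if f x J then yes else no)).+1.
  move=> /fintype.subsetP GF fb FG IH.
  have [||x xG le] := IH G.
  - by rewrite -card_gt0; move: F0 FG; rewrite -card_gt0; case: #|G| => //;
      case: #|F|.
  - by move=> x y xG yG E; apply: inj; rewrite ?GF //= !fb.
  exists x; first exact: GF.
  by rewrite fb // expnS mul2n (leq_trans FG) // leq_double.
have [le|/ltnW le] := leqP #|F :\: [set x | f x J]| #|F :&: [set x | f x J]|.
  apply: (step true (F :&: [set x | f x J])) => //.
  - exact: finset.subsetIl.
  - by move=> x; rewrite !inE => /andP[].
  - by rewrite -cF -addnn leq_add2l.
apply: (step false (F :\: [set x | f x J])) => //.
- exact: finset.subsetDl.
- by move=> x; rewrite !inE => /andP[/negbTE].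
- by rewrite -cF -addnn leq_add2r.
Qed.

(** The adversary always answers [b], so each query discards at most one candidate; the [.+1] is the
    one that may survive at the leaf. *)
Lemma decision_tree_elimination t F : F != finset.set0 ->
  (forall J, exists b, #|[set x in F | f x J != b]| <= 1) ->
  {in F &, injective (fun x => result (f x) t)} ->
  exists2 x, x \in F & #|F| <= (queries (f x) t).+1.
Proof.
elim: t F => [X|J yes IHyes no IHno] F F0 weak inj /=.
  have /finset.set0Pn[x xF] := F0.
  exists x => //; apply/card_le1_eqP => y z yF zF.
  exact: inj.
have [b bP] := weak J.
pose G := F :\: [set x in F | f x J != b].
have GP x : x \in G -> x \in F /\ f x J = b.
  by rewrite !inE => /andP[+ xF]; rewrite xF negbK => /eqP.
have FG : #|F| <= #|G|.+1.
  rewrite -(cardsID [set x in F | f x J != b] F) -add1n leq_add2r.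
  by apply: leq_trans bP; apply/subset_leq_card/finset.subsetIr.
(* If nobody is left, [F] had a single element and the bound is trivial. *)
have [G0|G0] := eqVneq G finset.set0.
  have /finset.set0Pn[x xF] := F0.
  by exists x => //; apply: leq_trans FG _; rewrite G0 cards0.
have IH : exists2 x, x \in G &
    #|G| <= (queries (f x) (if b then yes else no)).+1.
  have weakG I : exists b', #|[set x in G | f x I != b']| <= 1.
    have [b' b'P] := weak I; exists b'; apply: leq_trans b'P.
    apply/subset_leq_card/fintype.subsetP => x; rewrite !inE.
    by case/andP=> /andP[_ ->].
  have injG : {in G &, injective
      (fun x => result (f x) (if b then yes else no))}.
    move=> x y /GP[xF fx] /GP[yF fy] E; apply: inj => //=.
    by rewrite fx fy.
  by move: injG; case: (b) => injG; [apply: IHyes | apply: IHno].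
have [x xG le] := IH; have [xF fx] := GP _ xG.
by exists x => //; rewrite fx (leq_trans FG).
Qed.

End DecisionTrees.

(** * Repositories whose unknown dependencies form a cycle *)

Definition cycle_edges (P : finType) (S : {set P}) : {set P * P} :=
  [set (x, next (enum S) x) | x in S].

Lemma card_cycle_edges (P : finType) (S : {set P}) :
  #|cycle_edges S| <= #|S|.
Proof. exact: leq_imset_card. Qed.

(** [S] is a single orbit of [next (enum S)], so walking along the edges from [x] reaches all of
    it. *)
Lemma cycle_edges_closed (P : finType) (S I : {set P}) x :
  (forall e, e \in cycle_edges S -> e.1 \in I -> e.2 \in I) ->
  x \in S -> x \in I -> S \subset I.
Proof.
move=> closed xS xI; apply/fintype.subsetP => y yS.
have cyc := cycle_next (enum_uniq (mem S)).
have : fconnect (next (enum S)) x y.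
  by rewrite (fconnect_cycle cyc) mem_enum.
move/iter_findex <-; set k := findex _ _ _.
suff: (iter k (next (enum S)) x \in S) && (iter k (next (enum S)) x \in I).
  by case/andP.
elim: k => [|k /andP[kS kI]]; first by rewrite /= xS xI.
rewrite iterS -[X in X && _]mem_enum mem_next mem_enum kS /=.
exact: (closed (_, _) (imset_f _ kS)).
Qed.

Section CycleRepository.
Variables (P : finType) (Q D : {set P}).

Lemma acyclic0 : acyclic (finset.set0 : {set P * P}).
Proof. by case=> [//|x [|y s]] /=; rewrite inE. Qed.

Lemma cycle_success (I : {set P}) :
  reflect (I \subset ~: D /\
      forall e, e \in cycle_edges (Q :\: D) -> e.1 \in I -> e.2 \in I)
    (success finset.set0 (cycle_edges (Q :\: D)) finset.set0 D I).
Proof.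
apply: (iffP and3P) => [[dis /forall_inP cl _]|[sub cl]].
  split; first by rewrite -finset.disjoints_subset.
  by move=> e eU; apply/implyP/cl; rewrite !inE eU.
split; first by rewrite finset.disjoints_subset.
  by apply/forall_inP => e; rewrite !inE /= => eU; apply/implyP/cl.
by apply/forall_inP => c; rewrite inE.
Qed.

Lemma cycle_success_setC :
  success finset.set0 (cycle_edges (Q :\: D)) finset.set0 D (~: D).
Proof.
apply/cycle_success; split=> // e /imsetP[x xS ->] _ /=.
have : next (enum (Q :\: D)) x \in enum (Q :\: D).
  by rewrite mem_next mem_enum.
by rewrite mem_enum !inE => /andP[].
Qed.

Lemma no_conflict_pair (c : {set P}) :
  c \in (finset.set0 : {set {set P}}) -> #|c| = 2.
Proof. by rewrite inE. Qed.

(** The installation [~: D] witnesses every non-defect at once. *)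
Lemma cycle_defectsP p : p \in D <->
  ~ (exists I : {set P},
      p \in I /\ success finset.set0 (cycle_edges (Q :\: D)) finset.set0 D I).
Proof.
split=> [pD [I [pI /cycle_success[/fintype.subsetP sub _]]]|noI].
  by have := sub _ pI; rewrite inE pD.
apply: contra_notT noI => pD; exists (~: D).
by rewrite inE; split=> //; apply: cycle_success_setC.
Qed.

Definition cycle_repository : repository P :=
  Repository acyclic0 no_conflict_pair cycle_defectsP.

Lemma max_cycle_repository S :
  max_subrepository cycle_repository S -> S = ~: D.
Proof.
case=> /cycle_success[sub _] max; apply/eqP; rewrite eqEcard sub.
exact/max/cycle_success_setC.
Qed.

Lemma cycle_repository_admissible d u :
  #|D| <= d -> #|Q :\: D| <= u -> admissible d u cycle_repository.
Proof.
move=> Dd Qu; split=> //=.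
exact: leq_trans (card_cycle_edges _) Qu.
Qed.

(** A package of [I] in [Q] avoids [D], hence lies on the cycle and drags all of [Q :\: D] into
    [I]. *)
Lemma successful_cycle_repository (I : {set P}) :
  D \subset Q -> successful cycle_repository I ->
  [disjoint I & Q] \/ D = Q :\: I.
Proof.
move=> DQ /cycle_success[sub cl].
have [dis|/pred0Pn[x /andP[/= xI xQ]]] := boolP [disjoint I & Q].
  by left.
right; apply/finset.setP => y; rewrite !inE.
have ID z : z \in I -> z \notin D.
  by move=> /(fintype.subsetP sub); rewrite inE.
have xS : x \in Q :\: D by rewrite !inE xQ ID.
have /fintype.subsetP SI := cycle_edges_closed cl xS xI.
apply/idP/andP => [yD|[yI yQ]].
  by rewrite (fintype.subsetP DQ) //; split=> //; apply: contraL yD => /ID.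
by apply: contraNT yI => yD; apply: SI; rewrite !inE yD.
Qed.

Lemma successful_disjoint_cycle_repository (I : {set P}) :
  D \subset Q -> [disjoint I & Q] -> successful cycle_repository I.
Proof.
move=> DQ dis; apply/cycle_success; split.
  rewrite -finset.disjoints_subset; exact: disjointWr DQ dis.
move=> e /imsetP[x xS ->] /= xI; move: xS; rewrite !inE => /andP[_ xQ].
by have := disjointFr dis xI; rewrite xQ.
Qed.

End CycleRepository.

(** * The two lower bounds on the number of queries *)

Section LowerBounds.
Variables (P : finType) (d u : nat) (A : {set P * P} -> adaptive P).
Hypothesis A_solves : solves d u A.

Let oracle (Q D : {set P}) := successful (cycle_repository Q D).

(** A correct output is [~: D], which determines [D]. *)
Lemma solves_injective (Q : {set P}) (F : {set {set P}}) :
  {in F, forall D, admissible d u (cycle_repository Q D)} ->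
  {in F &, injective (fun D => result (oracle Q D) (A finset.set0))}.
Proof.
move=> adm D E /adm admD /adm admE /= eqDE; apply: finset.setC_inj.
have := max_cycle_repository (A_solves admD).
by rewrite -(max_cycle_repository (A_solves admE)) => <-.
Qed.

Lemma queries_information : 0 < d -> d <= #|P| ->
  exists2 r : repository P, admissible d u r &
    'C(#|P|, d) < 2 ^ queries (successful r) (A (known r)).
Proof.
move=> d0 dP; pose F := [set D : {set P} | #|D| <= d].
have adm : {in F, forall D, admissible d u (cycle_repository finset.set0 D)}.
  by move=> D; rewrite inE => ?; apply: cycle_repository_admissible;
     rewrite ?finset.set0D ?cards0.
have F0 : finset.set0 \in F by rewrite inE cards0.
have [||D DF le] := @decision_tree_leaves _ _ (oracle finset.set0)
    (A finset.set0) F.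
- by apply/set0Pn; exists finset.set0.
- exact: solves_injective.
exists (cycle_repository finset.set0 D); first exact: adm.
apply: leq_trans le; rewrite -card_draws.
(* The empty defect set is a candidate besides the [d]-subsets, since [0 < d]; this makes the
   inequality strict. *)
rewrite (cardsD1 finset.set0 F) F0 ltnS; apply/subset_leq_card.
apply/fintype.subsetP => D'; rewrite !inE => /eqP D'd.
by rewrite D'd leqnn andbT -card_gt0 D'd.
Qed.

Lemma queries_elimination : u + d <= #|P| ->
  exists2 r : repository P, admissible d u r &
    'C(u + d, d) <= (queries (successful r) (A (known r))).+1.
Proof.
move=> udP.
have /card_gt0P[Q] : 0 < #|[set Q : {set P} | #|Q| == u + d]|.
  by rewrite card_draws bin_gt0.
rewrite inE => /eqP cQ.
pose F := [set D : {set P} | D \subset Q & #|D| == d].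
have cF : #|F| = 'C(u + d, d) by rewrite cards_draws cQ.
have adm : {in F, forall D, admissible d u (cycle_repository Q D)}.
  move=> D; rewrite inE => /andP[DQ /eqP cD].
  by apply: cycle_repository_admissible; rewrite ?cD // cardsDS // cQ cD addnK.
have [|J||D DF le] := @decision_tree_elimination _ _ (oracle Q)
    (A finset.set0) F.
- by rewrite -card_gt0 cF bin_gt0 leq_addl.
(* The adversary lets [J] succeed exactly when it misses [Q]; only the candidate [Q :\: J] can
   disagree. *)
- exists [disjoint J & Q]; apply/card_le1_eqP => D E.
  have uniqJ D' : D' \in [set x in F | oracle Q x J != [disjoint J & Q]] ->
      D' = Q :\: J.
    rewrite !inE => /andP[/andP[DQ _]].
    have [dis|dis] := boolP [disjoint J & Q].
      by rewrite /oracle successful_disjoint_cycle_repository.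
    rewrite eqbF_neg negbK => /(successful_cycle_repository DQ).
    by rewrite (negbTE dis) => -[].
  by move=> /uniqJ -> /uniqJ ->.
- exact: solves_injective.
by exists (cycle_repository Q D); [exact: adm | rewrite -cF].
Qed.

End LowerBounds.

(** * Numerical estimates and conclusion *)

(** After multiplication by [d!] both sides are products over [i < d], compared factor by factor
    through [n * (d - i) <= (n - i) * d]. *)
Lemma expn_le_bin n d : d <= n -> n ^ d <= 'C(n, d) * d ^ d.
Proof.
move=> dn; have powE a : a ^ d = \prod_(i < d) a.
  by rewrite prod_nat_const card_ord.
rewrite -(leq_pmul2r (fact_gt0 d)) mulnAC bin_ffact -ffactnn.
rewrite !ffact_prod !powE -!big_split /=.
apply: leq_prod => i _; rewrite mulnBr mulnBl leq_sub2l //.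
by rewrite [n * i]mulnC leq_mul2l dn orbT.
Qed.

Import Order.TTheory GRing.Theory Num.Theory.
Local Open Scope ring_scope.

Lemma ln_bin_le (R : realType) (n d q : nat) :
  (0 < d)%N -> (d <= n)%N -> ('C(n, d) <= 2 ^ q)%N ->
  d%:R * ln (n%:R / d%:R) <= q%:R :> R.
Proof.
move=> d0 dn le.
have dR : 0 < d%:R :> R by rewrite ltr0n.
have ndR : 0 < n%:R / d%:R :> R by rewrite divr_gt0 // ltr0n (leq_trans d0).
(* This is [ln (1 + x) <= x] at [x = 1]; it absorbs the change from base 2 to the natural
   logarithm. *)
have ln2 : ln 2 <= 1 :> R.
  by have := @le_ln1Dx R 1; rewrite -[1 + 1]/(2%:R); apply; lra.
rewrite mulr_natl -lnXn //; apply: (@le_trans _ _ (ln (2 ^+ q))); last first.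
  by rewrite lnXn // -(mulr_natl (ln 2)) ler_piMr ?ler0n.
rewrite ler_ln ?posrE ?exprn_gt0 // expr_div_n ler_pdivrMr ?exprn_gt0 //.
rewrite -!natrX -natrM ler_nat (leq_trans (expn_le_bin dn)) //.
by rewrite leq_mul2r le orbT.
Qed.

(* For d = 0 the bound is undefined, and for u + d > n it fails in general:
   with d = 1, n + 1 queries always suffice, whereas 'C(u + 1, 1) = u + 1. *)
Theorem theorem6 (R : realType) :
  exists2 c : R, 0 < c &
    forall (P : finType) (n d u : nat),
      #|P| = n -> (0 < d)%N -> (u + d <= n)%N ->
      forall A : {set P * P} -> adaptive P, solves d u A ->
        exists2 r : repository P, admissible d u r &
          c * ('C(u + d, d)%:R + d%:R * ln (n%:R / d%:R))
            <= (queries (successful r) (A (known r)))%:R.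
Proof.
(* With [q] the larger of the two costs, the binomial is at most [q + 1 <= 2 * q] and the
   logarithmic term at most [q]. *)
exists (1 / 3) => [|P n d u Pn d0 udn A solA]; first by lra.
have dn : (d <= n)%N by rewrite (leq_trans _ udn) // leq_addl.
have [|r1 adm1 q1] := queries_information solA d0; first by rewrite Pn.
have [|r2 adm2 q2] := queries_elimination solA; first by rewrite Pn.
rewrite Pn in q1.
have bound q : (queries (successful r1) (A (known r1)) <= q)%N ->
    (queries (successful r2) (A (known r2)) <= q)%N ->
    1 / 3 * ('C(u + d, d)%:R + d%:R * ln (n%:R / d%:R)) <= q%:R :> R.
  move=> le1 le2.
  have lnq : d%:R * ln (n%:R / d%:R) <= q%:R :> R.
    by apply: ln_bin_le => //; rewrite (leq_trans (ltnW q1)) // leq_exp2l.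
  (* ['C(n, d) < 2 ^ q] also forces [q > 0], which absorbs the additive 1 *)
  have q_gt0 : 1 <= q%:R :> R.
    rewrite ler1n (leq_trans _ le1) // lt0n; apply: contraTneq q1 => ->.
    by rewrite expn0 -leqNgt bin_gt0.
  have Cq : 'C(u + d, d)%:R <= q%:R + 1 :> R.
    by rewrite natr1 ler_nat (leq_trans q2).
  by lra.
have [le|/ltnW le] := leqP (queries (successful r1) (A (known r1)))
                           (queries (successful r2) (A (known r2))).
- by exists r2 => //; apply: bound.
- by exists r1 => //; apply: bound.
Qed.
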